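(* There is an uncountable family of pairwise non-homeomorphic analytic sequential spaces of sequential order $\omega_1$.
   Context: An analytic space is a countable topological space $X$ whose topology, viewed as a subset of $2^X$ by identifying subsets of $X$ with characteristic functions, is analytic. A topological space $X$ is sequential if whenever $A\subseteq X$ is not closed, there is a sequence in $A$ converging to a point not in $A$. For $A\subseteq X$ put $[A]_0=A$, let $[A]_{\alpha+1}$ be the set of all limits of convergent sequences of points of $[A]_\alpha$, and $[A]_\lambda=\bigcup_{\alpha<\lambda}[A]_\alpha$ for limit $\lambda$; the sequential order of a sequential space $X$ is the least ordinal $\alpha$ such that $[A]_\alpha=\overline{A}$ for every $A\subseteq X$. *)

(* Defs.v *)
From HB Require Import structures.
From mathcomp Require Import all_boot all_order.
From mathcomp Require Import all_classical wochoice topology.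
Set Implicit Arguments.
Unset Strict Implicit.
Unset Printing Implicit Defensive.

Local Open Scope classical_set_scope.

(* Analytic subsets in the usual sense when [T] is Polish; below [T] is
   [{ptws X -> bool}] with [X] countable. *)
Definition analytic_set (T : topologicalType) (S : set T) : Prop :=
  S = set0 \/ exists2 f : {ptws nat -> nat} -> T, continuous f & range f = S.

Definition char_fun (X : Type) (U : set X) : {ptws X -> bool} :=
  fun x => `[< U x >].

Definition analytic_space (X : topologicalType) : Prop :=
  countable [set: X] /\ analytic_set (@char_fun X @` [set U : set X | open U]).

Definition homeomorphic (X Y : topologicalType) : Prop :=
  exists (f : X -> Y) (g : Y -> X),
    [/\ continuous f, continuous g, cancel f g & cancel g f].

Definition seq_limits (X : topologicalType) (A : set X) : set X :=
  [set x | exists u : nat -> X, (forall n, A (u n)) /\ u @ \oo --> x].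

Definition sequential_space (X : topologicalType) : Prop :=
  forall A : set X, ~ closed A -> exists x, seq_limits A x /\ ~ A x.

(* A point [p] of a well-ordered type, standing for the order type of
   [{v | v < p}]. The ordinals smaller than [p] are then exactly those given
   by the points [v < p] of the same well-ordered type. *)
Record wo_ordinal := WoOrdinal {
  wo_carrier : eqType;
  wo_le : rel wo_carrier;
  wo_leP : well_order wo_le;
  wo_point : wo_carrier
}.

Section WellOrder.
Variables (W : eqType) (le : rel W).

Definition wo_lt (v w : W) : bool := (v != w) && le v w.

Definition wo_below (w : W) : set W := [set v | wo_lt v w].

Definition wo_zero (w : W) : Prop := forall v, ~ wo_lt v w.

Definition wo_succ (v w : W) : Prop :=
  wo_lt v w /\ forall u, wo_lt u w -> le u v.

Definition wo_limit (w : W) : Prop :=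
  ~ wo_zero w /\ forall v, ~ wo_succ v w.

(* [seq_stage A w] is [A]_w. The premises of the three constructors are
   mutually exclusive, so for a well-order this is definition by transfinite
   recursion; see [seq_stage_zero], [seq_stage_succ], [seq_stage_limit]. *)
Inductive seq_stage (X : topologicalType) (A : set X) : W -> set X :=
| SeqStageZero w x : wo_zero w -> A x -> seq_stage A w x
| SeqStageSucc v w (u : nat -> X) x : wo_succ v w ->
    (forall n, seq_stage A v (u n)) -> u @ \oo --> x -> seq_stage A w x
| SeqStageLimit v w x : wo_limit w -> wo_lt v w ->
    seq_stage A v x -> seq_stage A w x.

End WellOrder.

Section WellOrderTheory.
Variables (W : eqType) (le : rel W) (wo : well_order le).

Let tot : total le.
Proof.
by move=> x y; apply: (@wo_chainW _ le predT) => //; apply: withinW.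
Qed.

Let anti x y : le x y -> le y x -> x = y.
Proof.
move=> xy yx; apply: (@wo_chain_antisymmetric _ le predT) => //.
- exact: withinW.
- by rewrite xy yx.
Qed.

Lemma wo_succ_inj v v' w : wo_succ le v w -> wo_succ le v' w -> v = v'.
Proof. by move=> [a b] [c d]; apply: anti; [apply: d | apply: b]. Qed.

Variables (X : topologicalType) (A : set X).

Lemma seq_stage_zero w : wo_zero le w -> seq_stage le A w = A.
Proof.
move=> w0; apply/seteqP; split=> x; last exact: SeqStageZero.
move=> H; case: H w0 => {w x} [w x _ //|v w u x [vw _] _ _ /(_ v)//|].
by move=> v w x [w0 _] _ _ /w0.
Qed.

Lemma seq_stage_succ v w : wo_succ le v w ->
  seq_stage le A w = seq_limits (seq_stage le A v).
Proof.
move=> vw; apply/seteqP; split=> x; last first.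
  by move=> [u [uA ux]]; exact: SeqStageSucc vw uA ux.
move=> H; case: H vw => {w x} [w x w0 _ [/w0]//|v' w u x v'w uA ux vw|].
  by rewrite (wo_succ_inj vw v'w); exists u.
by move=> v' w x [_ wS] _ _ /wS.
Qed.

Lemma seq_stage_limit w : wo_limit le w ->
  seq_stage le A w = \bigcup_(v in wo_below le w) seq_stage le A v.
Proof.
move=> lw; apply/seteqP; split=> x; last first.
  by move=> [v /= vw vx]; exact: SeqStageLimit lw vw vx.
move=> H; case: H lw => {w x} [w x w0 _ [/(_ w0)]//|v w u x vw _ _ [_ /(_ v)]//|].
by move=> v w x _ vw vx _; exists v.
Qed.

End WellOrderTheory.

(* Meaningful for sequential [X] only. *)
Definition has_sequential_order (X : topologicalType) (a : wo_ordinal) : Prop :=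
  (forall A : set X, seq_stage (@wo_le a) A (wo_point a) = closure A) /\
  (forall b : wo_carrier a, wo_lt (@wo_le a) b (wo_point a) ->
     ~ (forall A : set X, seq_stage (@wo_le a) A b = closure A)).

Definition is_omega1 (a : wo_ordinal) : Prop :=
  ~ countable (wo_below (@wo_le a) (wo_point a)) /\
  (forall b : wo_carrier a, wo_lt (@wo_le a) b (wo_point a) ->
     countable (wo_below (@wo_le a) b)).

Lemma uncountable_cantor : ~ countable [set: nat -> bool].
Proof.
move=> /countable_injP[f fI].
pose D : nat -> bool := fun n => `[< exists a, f a = n /\ a n = false >].
have [Df|/negP nD] := boolP (D (f D)).
  have /asboolP[a [fa]] := Df.
  have -> : a = D by apply: fI => //; rewrite in_setT.
  by rewrite Df.
by apply: (nD); apply/asboolP; exists D; split=> //; apply/negP.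
Qed.

Definition top_le (T : Type) (R : rel T) : rel (option T) := fun a b =>
  match a, b with
  | _, None => true
  | None, Some _ => false
  | Some x, Some y => R x y
  end.

Lemma top_le_wo (T : eqType) (R : rel T) : well_order R -> well_order (top_le R).
Proof.
move=> wo B [b0 Bb0].
have [[x Bx]|nB] := pselect (exists x, Some x \in B).
  have [|z [[zB zmin] zu]] := wo [pred y | Some y \in B]; first by exists x.
  exists (Some z); split.
    by split=> // -[y|] // yB; exact: zmin.
  move=> [y|] [yB ymin]; last by have := ymin _ zB.
  by congr Some; apply: zu; split=> // t tB; exact: (ymin (Some t)).
have B0 b : b \in B -> b = None by case: b => // y yB; case: nB; exists y.
exists None; split; last by move=> y [/B0].
by split=> [|y /B0 ->]; [rewrite -(B0 _ Bb0)|].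
Qed.

Lemma omega1_exists : exists a, is_omega1 a.
Proof.
pose T : eqType := nat -> bool.
have [R woR] := well_ordering_principle T.
have wo := top_le_wo woR; set L := top_le R in wo.
pose B : {pred option T} := fun w => `[< ~ countable (wo_below L w) >].
have [|p [[/asboolP pB pmin] _]] := wo B.
  exists None; apply/asboolP => cN; apply: uncountable_cantor.
  have /countable_injP[f fI] := cN.
  have inN x : Some x \in wo_below L None by rewrite inE.
  apply/countable_injP; exists (f \o Some) => x y _ _ e.
  by have [] := fI _ _ (inN x) (inN y) e.
exists (WoOrdinal wo p); split=> //= b /andP[bp lbp].
apply: contrapT => nb; have /pmin pb : b \in B by apply/asboolP.
move/negP: bp; apply; apply/eqP.
apply: (@wo_chain_antisymmetric _ L predT) => //; first exact: withinW.
by rewrite lbp.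
Qed.

Definition omega1 : wo_ordinal := projT1 (cid omega1_exists).

Lemma omega1P : is_omega1 omega1.
Proof. exact: projT2 (cid omega1_exists). Qed.

(* Main.v *)
From HB Require Import structures.
Require Import Defs.
From mathcomp Require Import all_boot all_order.
From mathcomp Require Import all_classical wochoice topology.
Set Implicit Arguments.
Unset Strict Implicit.
Unset Printing Implicit Defensive.
Local Open Scope classical_set_scope.

(** On the tree of finite sequences of integers fix a set [E] of nodes, and
  call a set open when, with each of its nodes lying in [E], it contains
  almost all children of that node. This space is sequential, and a sequence
  converges to [s] only if its terms are eventually [s] or children of [s].
  If all extensions of some node are in [E], the space contains the
  Arkhangel'skii-Franklin space, whose sequential order is omega_1: given
  sets [A_n] below the children of [s], reaching them only after the stages
  [w_n], their union reaches [s] only after all the [w_n].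

  A set [r] of integers is coded by adding to such an [E] nodes [p_n], for [n]
  in [r], half of whose children are isolated and half of which are roots of
  trees of height [n + 1]. Call a point of level [0] when it is isolated, and
  of level [k + 1] when it is the limit of a sequence of other points of level
  [k]. Then [n] is in [r] iff some point has both levels [1] and [n + 2]. *)

Lemma suffix_consr (T : eqType) (s t : seq T) x :
  suffix s (x :: t) = (s == x :: t) || suffix s t.
Proof.
apply/idP/orP => [/suffixP[[|y w] /= e]|[/eqP ->|st]].
- by left; rewrite e.
- by right; case: e => _ ->; exact: suffix_suffix.
- exact: suffix_refl.
- by rewrite -cat1s suffix_catr.
Qed.

Lemma cons_neq (T : Type) (x : T) s : x :: s <> s.
Proof. by elim: s x => // y s IH x [_ /IH]. Qed.

(* The child of index [n] of the node [s] is [n :: s], so that sequences are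
   read from the leaf to the root. *)
Definition tree_space (E : pred (seq nat)) : Type := seq nat.

HB.instance Definition _ E := Countable.copy (tree_space E) (seq nat).

(** * The tree topology: convergence, sequentiality, analyticity *)

Section TreeSpace.
Variable E : pred (seq nat).
Local Notation X := (tree_space E).
Implicit Types (s t : seq nat) (U A : set X).

Definition tree_open U :=
  forall s, U s -> E s -> exists m, forall n, m <= n -> U (n :: s).

Let tree_openT : tree_open setT.
Proof. by move=> s _ _; exists 0. Qed.

Let tree_openI : setI_closed tree_open.
Proof.
move=> U V oU oV s [Us Vs] Es.
have [m mU] := oU _ Us Es; have [k kV] := oV _ Vs Es.
exists (maxn m k) => n; rewrite geq_max => /andP[mn kn].
by split; [exact: mU | exact: kV].
Qed.

Let tree_open_bigU (I : Type) (f : I -> set X) :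
  (forall i, tree_open (f i)) -> tree_open (\bigcup_i f i).
Proof.
move=> of_ s [i _ fis] Es; have [m mf] := of_ i _ fis Es.
by exists m => n mn; exists i => //; exact: mf.
Qed.

HB.instance Definition _ :=
  isOpenTopological.Build X tree_openT tree_openI tree_open_bigU.

Lemma tree_openE U : open U = tree_open U.
Proof. by []. Qed.

Lemma cvg_eventually (u : nat -> X) (x : X) U :
  u @ \oo --> x -> open U -> U x -> \forall n \near \oo, U (u n).
Proof. by move=> ux oU Ux; apply: (ux); apply: open_nbhs_nbhs. Qed.

Definition cone s : set X := [set t | suffix s t].

Lemma open_cone s : open (cone s).
Proof.
by move=> t st _; exists 0 => n _; rewrite /cone /= suffix_consr st orbT.
Qed.

Lemma open_cone_setC s : open (~` cone s).
Proof.
(* At most one child of [t] enters the cone, namely [s] itself, whose index is [head 0 s]. *)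
move=> t /= /negP st _; exists (head 0 s).+1 => n hn; apply/negP.
rewrite /cone /= suffix_consr negb_or st andbT.
by apply: contraTneq hn => ->; rewrite /= ltnn.
Qed.

Lemma child_cvg s : E s -> (fun n => n :: s : X) @ \oo --> (s : X).
Proof.
move=> Es U; rewrite nbhsE => -[V [oV Vs] VU].
have [m mV] := oV _ Vs Es.
by exists m => // n /= mn; apply: VU; exact: mV.
Qed.

Lemma tree_isolated s : open [set (s : X)] <-> ~~ E s.
Proof.
rewrite tree_openE; split=> [o|nEs t -> Es]; last by rewrite Es in nEs.
apply/negP => Es; have [m /(_ m (leqnn m))] := o s erefl Es.
exact: cons_neq.
Qed.

Lemma cvg_children_seq s (f : nat -> nat) : E s -> (forall m, m <= f m) ->
  (fun m => f m :: s : X) @ \oo --> (s : X).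
Proof.
move=> Es fle; apply: (cvg_comp f (fun n => n :: s : X)) (child_cvg Es).
by move=> P [N _ NP]; exists N => // n Nn; apply: NP; exact: leq_trans (fle n).
Qed.

Lemma cvg_outside s (r : seq nat) (u : nat -> X) :
  u @ \oo --> (s : X) -> ~~ suffix r s ->
  \forall n \near \oo, ~~ suffix r (u n).
Proof.
move=> us rs; have := cvg_eventually us (@open_cone_setC r) (elimN idP rs).
by apply: filterS => n /negP.
Qed.

(* The set [U] below removes from the cone of [s] the cones of the terms that
   are at least two levels below [s]; it is open because only finitely many
   terms lie below a given child of [s]. *)
Lemma cvg_children s (u : nat -> X) m : u @ \oo --> (s : X) ->
  \forall n \near \oo, u n = s \/ (E s /\ exists2 k, m <= k & u n = k :: s).
Proof.
move=> us.
pose deep n := suffix s (u n) && (size s + 1 < size (u n)).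
pose U : set X := [set t | suffix s t /\ forall n, deep n -> ~~ suffix (u n) t].
have oU : open U.
  move=> t [st dt] Et.
  have sc n : suffix s (n :: t) by rewrite suffix_consr st orbT.
  have [ts|[r rs rt]] : t = s \/
      exists2 r, ~~ suffix r s & exists k, r = k :: s /\ suffix r t.
    have /suffixP[w] := st; case/lastP: w => [|w k] tE; first by left.
    right; exists (k :: s).
      by apply/negP => /size_suffix; rewrite /= ltnn.
    by exists k; split=> //; rewrite tE cat_rcons suffix_suffix.
    exists 0 => n _; split=> // k /andP[_ sz].
    apply/negP => /size_suffix; rewrite ts /= leqNgt => /negP; apply.
    by rewrite -addn1.
  (* From [N] on no term lies below [r], so only finitely many terms can be children of [t]; larger
     indices avoid them. *)
  have [N _ Nr] := cvg_outside us rs.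
  exists (\max_(n < N) (head 0 (u n))).+1 => n Mn; split=> // k dk.
  rewrite suffix_consr (negbTE (dt _ dk)) orbF.
  apply: contraTneq Mn => uk; rewrite -leqNgt.
  have kN : k < N.
    rewrite ltnNge; apply/negP => /Nr /=; case: rt => j [_ rt].
    by rewrite uk suffix_consr rt orbT.
  by rewrite (leq_trans _ (leq_bigmax (Ordinal kN))) // uk.
have Us : U s.
  split; first exact: suffix_refl.
  move=> n /andP[_]; rewrite ltnNge; apply: contra => /size_suffix h.
  by rewrite (leq_trans h) // leq_addr.
have uU := cvg_eventually us oU Us.
have um : \forall n \near \oo, forall i, i < m -> ~~ suffix (i :: s) (u n).
  elim: m => [|m IH]; first by exists 0.
  have : ~~ suffix (m :: s) s by apply/negP => /size_suffix; rewrite /= ltnn.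
  move=> /(cvg_outside us); move: IH; apply: filterS2 => n H1 H2 i.
  by rewrite ltnS leq_eqVlt => /orP[/eqP ->//|]; exact: H1.
have uE : \forall n \near \oo, ~~ E s -> u n = s.
  have [Es|nEs] := boolP (E s); first by exists 0.
  by have := cvg_eventually us ((tree_isolated s).2 nEs) erefl; apply: filterS.
move: uU um uE; apply: filterS3 => n [sun dun] un_m un_E.
have : ~~ deep n by apply/negP => /dun; rewrite suffix_refl.
rewrite /deep sun /= -leqNgt; have /suffixP[w uw] := sun.
rewrite uw size_cat addnC leq_add2l; case: w uw => [|k [|//]] /= uw _.
  by left.
have [Es|nEs] := boolP (E s); last first.
  by case: (cons_neq (etrans (esym uw) (un_E nEs))).
right; split=> //; exists k => //; rewrite leqNgt; apply/negP => /un_m.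
by rewrite uw suffix_refl.
Qed.

(** If [A] is not closed, some [s] in [E] outside [A] has infinitely many children in [A], and these
    converge to [s]. *)
Lemma tree_sequential : sequential_space X.
Proof.
move=> A; rewrite -openC tree_openE => /existsNP[s /not_implyP[nAs]].
move=> /not_implyP[Es /forallNP ex].
have {}ex m : exists n, m <= n /\ A (n :: s).
  have /existsNP[n /not_implyP[mn /contrapT Ans]] := ex m.
  by exists n.
have [f fP] := choice ex.
exists s; split=> //; exists (fun n => f n :: s); split.
  by move=> n; case: (fP n).
by apply: cvg_children_seq => // n; case: (fP n).
Qed.

(* A code [g] gives a set [V], read off the parities of [g], and a choice of
   cofinite sets of children, read off the halves; [decode g] is the set
   generated by [V] under passing to the chosen children. *)
Fixpoint decode (g : nat -> nat) s : bool :=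
  odd (g (pickle s)) ||
  (if s is n :: t then [&& decode g t, E t & (g (pickle t))./2 <= n]
   else false).

Lemma decode_open g : open ([set s | decode g s] : set X).
Proof.
move=> s /= gs Es; exists (g (pickle s))./2 => n hn.
by rewrite gs Es hn orbT.
Qed.

Lemma decode_onto U : open U -> exists g, forall s, decode g s = `[< U s >].
Proof.
move=> oU.
have /choice[F FP] s : exists m, U s -> E s -> forall n, m <= n -> U (n :: s).
  have [Us|] := pselect (U s); last by exists 0.
  have [Es|] := boolP (E s); last by exists 0.
  by have [m mU] := oU _ Us Es; exists m.
(* The parity records [U] and the half records [F s]; the chosen children of points of [U] are
   already in [U], so generation adds nothing. *)
pose g c := if unpickle c is Some s then `[< U s >] + (F s).*2 else 0.
have gE s : g (pickle s) = `[< U s >] + (F s).*2 by rewrite /g pickleK.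
exists g.
elim=> [|n t IH]; rewrite [LHS]/= !gE oddD odd_double addbF oddb ?orbF //.
apply/orb_idr; rewrite IH half_bit_double => /and3P[/asboolP Ut Et Fn].
by apply/asboolP; exact: FP Fn.
Qed.

(** Decoding at [s] reads [g] only at the codes of the finitely many suffixes of [s]; this makes
    decoding continuous. *)
Lemma decode_near (g : {ptws nat -> nat}) s :
  \forall h \near g, decode h s = decode g s.
Proof.
have near_at c : \forall h \near g, h c = g c.
  have := @proj_continuous nat (fun=> nat) c g [set g c].
  by apply; exact: discrete_set1.
elim: s => [|n t IH].
  by have := near_at (pickle ([::] : seq nat)); apply: filterS => h /= ->.
move: IH (near_at (pickle t)) (near_at (pickle (n :: t))).
by apply: filterS3 => h /= -> -> ->.
Qed.

Lemma tree_analytic : analytic_space X.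
Proof.
split; first exact: countableP.
right; exists (fun g => char_fun [set s : X | decode g s]).
  move=> g; apply/(@pointwise_cvgP X bool) => s.
  apply: cvg_near_cst; have := decode_near g s.
  by apply: filterS => h hE; rewrite /char_fun /= hE.
apply/seteqP; split=> [_ [g _ <-]|_ [U oU <-]].
  by exists [set s | decode g s] => //; exact: decode_open.
have [g gU] := decode_onto oU; exists g => //.
by congr char_fun; apply/seteqP; split=> s /=; rewrite gU => /asboolP.
Qed.

End TreeSpace.

(** * Well-orders and stages of the sequential closure *)

Section WellOrderFacts.
Variables (W : eqType) (le : rel W) (wo : well_order le).
Local Notation lt := (wo_lt le).

Lemma wo_refl : reflexive le.
Proof.
by move=> x; apply: (@wo_chain_reflexive _ le predT) => //; exact: withinW.
Qed.

Lemma wo_total : total le.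
Proof. by move=> x y; apply: (@wo_chainW _ le predT) => //; exact: withinW. Qed.

Lemma wo_anti : antisymmetric le.
Proof.
move=> x y; apply: (@wo_chain_antisymmetric _ le predT) => //.
exact: withinW.
Qed.

Lemma wo_trans : transitive le.
Proof.
move=> y x z xy yz.
(* Whichever of the three points is the least, antisymmetry settles the case. *)
have [|m [[m3 mmin] _]] := wo (A := mem [:: x; y; z]).
  by exists x; exact: mem_head.
have [mx my mz] : [/\ le m x, le m y & le m z].
  by split; apply: mmin; rewrite !inE eqxx ?orbT.
move: m3; rewrite !inE => /or3P[] /eqP mE; rewrite -?mE // in mx my mz *.
  by rewrite (@wo_anti x y) ?xy -?mE // in mz *.
by rewrite (@wo_anti m y) // my mE yz.
Qed.

Lemma wo_ltNge v w : lt v w = ~~ le w v.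
Proof.
rewrite /wo_lt; apply/andP/negP => [[/negP vw lvw] lwv|nwv].
  by apply: vw; apply/eqP/wo_anti; rewrite lvw.
split; last by case/orP: (wo_total v w).
by apply: contra_notN nwv => /eqP ->; exact: wo_refl.
Qed.

Lemma wo_leNgt v w : le v w = ~~ lt w v.
Proof. by rewrite wo_ltNge negbK. Qed.

Lemma wo_ltW v w : lt v w -> le v w.
Proof. by case/andP. Qed.

Lemma wo_lt_le_trans u v w : lt u v -> le v w -> lt u w.
Proof.
rewrite !wo_ltNge => + vw; apply: contra; exact: wo_trans.
Qed.

Lemma wo_le_lt_trans u v w : le u v -> lt v w -> lt u w.
Proof.
by rewrite !wo_ltNge => uv; apply: contra => wu; exact: wo_trans uv.
Qed.

Lemma wo_min (P : W -> Prop) : (exists w, P w) ->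
  exists2 w, P w & forall v, P v -> le w v.
Proof.
move=> [w Pw].
have [|m [[/asboolP Pm mmin] _]] := wo (A := fun w => `[< P w >]).
  by exists w; apply/asboolP.
by exists m => // v Pv; apply: mmin; apply/asboolP.
Qed.

Lemma wo_induction (P : W -> Prop) :
  (forall w, (forall v, lt v w -> P v) -> P w) -> forall w, P w.
Proof.
move=> IH w; apply: contrapT => nPw.
have [|m nPm mmin] := @wo_min (fun w => ~ P w); first by exists w.
apply: nPm; apply: IH => v; rewrite wo_ltNge => mv.
by apply: contrapT => /mmin; exact/negP.
Qed.

Variant wo_cases w : Prop :=
| WoZero of wo_zero le w
| WoSucc v of wo_succ le v w
| WoLimit of wo_limit le w.

Lemma wo_casesP w : wo_cases w.
Proof.
have [|nz] := pselect (wo_zero le w); first exact: WoZero.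
have [[v]|ns] := pselect (exists v, wo_succ le v w); first exact: WoSucc.
by apply: WoLimit; split=> // v vw; apply: ns; exists v.
Qed.

Section Stages.
Variables (X : topologicalType) (A : set X).

Lemma seq_stage_sub w : A `<=` seq_stage le A w.
Proof.
move: w; apply: wo_induction => w IH x Ax.
have [w0|v vw|[nz nS]] := wo_casesP w.
- exact: SeqStageZero.
- apply: (SeqStageSucc vw _ (cvg_cst x)) => _; apply: IH => //.
  by case: vw.
- have /existsNP[v /contrapT vw] := nz.
  by apply: (SeqStageLimit _ vw); [split | exact: IH].
Qed.

Lemma seq_stage_mono v w : le v w -> seq_stage le A v `<=` seq_stage le A w.
Proof.
move: w; apply: wo_induction => w IH vw x Ax.
have [->//|nvw] := eqVneq w v.
have ltvw : lt v w by rewrite /wo_lt eq_sym nvw.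
have [/(_ v)//|u [uw uS]|wlim] := wo_casesP w; last exact: SeqStageLimit Ax.
apply: (SeqStageSucc (conj uw uS) _ (cvg_cst x)) => _.
by apply: IH => //; exact: uS.
Qed.

Lemma seq_stage_closure w : seq_stage le A w `<=` closure A.
Proof.
move=> x; elim=> {w x} [w x _ /subset_closure//|v w u x _ _ IH ux|//].
apply: (closed_cvg _ (@closed_closure _ A) _ _ ux).
by exists 0 => // n _; exact: IH.
Qed.

(** A sequence converging to a point of [C] is eventually in [C], so a tail of it stays inside. *)
Lemma seq_stage_local (C : set X) w x : open C -> C x ->
  seq_stage le A w x -> seq_stage le (A `&` C) w x.
Proof.
move=> oC + H; elim: H => {w x}
  [w x w0 Ax Cx|v w u x vw _ IH ux Cx|v w x lw vw _ IH Cx].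
- exact: SeqStageZero.
- have [N _ NC] : \forall n \near \oo, C (u n).
    by apply: ux; apply: open_nbhs_nbhs.
  apply: (SeqStageSucc (u := fun n => u (n + N)) vw) => [n|].
    by apply: IH; apply: NC; exact: leq_addl.
  exact: (cvg_comp _ _ (cvg_addnr N) ux).
- exact: SeqStageLimit lw vw (IH Cx).
Qed.

End Stages.
End WellOrderFacts.

(** * All stages close up by omega_1 *)

Section Omega1.
Variables (a : wo_ordinal) (a1 : is_omega1 a).
Local Notation W := (wo_carrier a).
Local Notation le := (@wo_le a).
Local Notation lt := (wo_lt le).
Local Notation p := (wo_point a).
Let wo : well_order le := @wo_leP a.

(** Otherwise the points [f n] and their predecessors, a countable union of countable sets, exhaust
    the predecessors of [p]. *)
Lemma omega1_bounded (f : nat -> W) : (forall n, lt (f n) p) ->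
  exists2 w, lt w p & forall n, lt (f n) w.
Proof.
move=> fp; apply: contrapT => nb; case: a1 => + cb; apply.
have {}nb w : lt w p -> exists n, le w (f n).
  move=> wp; apply: contrapT => /forallNP nf; apply: nb; exists w => // n.
  by rewrite (wo_ltNge wo); apply/negP/nf.
pose F i := if i.2 then wo_below le (f i.1) else [set f i.1].
apply: (@sub_countable _ _ _ (\bigcup_(i : nat * bool) F i)).
  apply: subset_card_le => w /nb[n wf].
  have [->|nw] := eqVneq w (f n); first by exists (n, false).
  by exists (n, true) => //; apply/andP.
apply: bigcup_countable => [|[n []] _]; first exact: countableP.
- exact: cb.
- exact: countable1.
Qed.

Lemma omega1_limit : wo_limit le p.
Proof.
split=> [p0|v [vp vmax]].
  case: a1 => + _; apply; suff -> : wo_below le p = set0 by [].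
  by apply/seteqP; split=> // v /p0.
have [w wp vw] := @omega1_bounded (fun=> v) (fun=> vp).
by have := vmax _ wp; rewrite (wo_leNgt wo) (vw 0).
Qed.

Lemma omega1_succ v : lt v p -> exists2 w, lt w p & wo_succ le v w.
Proof.
move=> vp; have [u up vu] := @omega1_bounded (fun=> v) (fun=> vp).
have [|w vw wmin] := @wo_min _ _ wo (fun w => lt v w).
  by exists u; exact: vu 0.
exists w; first by apply: (wo_le_lt_trans wo) up; exact: wmin (vu 0).
split=> // t; rewrite (wo_leNgt wo) (wo_ltNge wo).
by apply: contra; exact: wmin.
Qed.

(** Stage [p] is closed: by [omega1_bounded] a sequence in it lies in one earlier stage, so its
    limit appears at the next. *)
Lemma seq_stage_omega1 (X : topologicalType) (A : set X) :
  sequential_space X -> seq_stage le A p = closure A.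
Proof.
move=> sX; apply/seteqP; split; first exact: seq_stage_closure.
have -> : closure A = smallest closed A by rewrite closureE.
apply: smallest_sub; last exact: seq_stage_sub.
apply: contrapT => /sX[x [[u [uA ux]] nAx]]; apply: nAx.
move: uA; rewrite (seq_stage_limit _ omega1_limit) => uA.
have {uA}/choice[f fP] n : exists v, lt v p /\ seq_stage le A v (u n).
  by have [v vp uv] := uA n; exists v.
have [n|w wp fw] := @omega1_bounded f; first by case: (fP n).
have [w' w'p ww'] := omega1_succ wp.
exists w' => //; apply: (SeqStageSucc ww' _ ux) => n.
by have [_] := fP n; apply: (seq_stage_mono wo); exact: wo_ltW.
Qed.

End Omega1.

(** * Lower bound for the sequential order *)

Section TreeOrder.
Variable E : pred (seq nat).
Local Notation X := (tree_space E).
Variables (W : eqType) (le : rel W) (wo : well_order le).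
Local Notation lt := (wo_lt le).

(** Only finitely many predecessors [v] of [b] have [f v <= n]; the largest of these and [d] is
    below [b]. *)
Lemma finite_bound (b d : W) (f : W -> nat) n :
  lt d b -> set_inj (wo_below le b) f ->
  exists2 w, lt w b & forall v, lt v b -> f v <= n -> le v w.
Proof.
move=> db fI.
suff [w wb wP] : exists2 w, lt w b & forall v, lt v b -> f v < n.+1 -> le v w.
  by exists w.
elim: n.+1 => [|k [w wb wP]]; first by exists d.
have [[v vb fv]|nv] := pselect (exists2 v, lt v b & f v = k); last first.
  exists w => // v vb; rewrite ltnS leq_eqVlt => /orP[/eqP fv|]; last exact: wP.
  by case: nv; exists v.
have fk u : lt u b -> f u <= k -> u = v \/ f u < k.
  move=> ub; rewrite leq_eqVlt => /orP[/eqP fu|]; last by right.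
  by left; apply: fI; rewrite ?inE // fu.
case/orP: (wo_total wo v w) => vw.
  by exists w => // u ub; rewrite ltnS => /(fk _ ub)[->//|]; exact: wP.
exists v => // u ub; rewrite ltnS => /(fk _ ub)[->|ufn]; first exact: wo_refl.
by apply: (wo_trans wo) vw; exact: wP.
Qed.

(** Induction on [b], with its predecessors numbered by an injective [f]: below [n :: s] goes a set
    that delays this child past each [v] with [f v <= n]. Reaching [s] from stage [v] would use a
    child of index at least [f v], which that stage does not contain. *)
Lemma late_stage b : countable (wo_below le b) ->
  forall s, (forall t, E (t ++ s)) ->
  exists A : set X, [/\ A `<=` cone s, closure A s &
    forall v, le v b -> ~ seq_stage le A v s].
Proof.
move: b; apply: (wo_induction wo) => b IH /[dup] cb /countable_injP[f fI] s Es.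
have /choice[A AP] n : exists A : set X, [/\ A `<=` cone (n :: s),
    closure A (n :: s) &
    forall v, lt v b -> f v <= n -> ~ seq_stage le A v (n :: s)].
  have [[d db]|nd] := pselect (exists d, lt d b); last first.
    exists (cone (n :: s)); split=> //.
      by apply: subset_closure; exact: suffix_refl.
    by move=> v vb; case: nd; exists v.
  have [w wb wP] := finite_bound n db fI.
  have [|t|A [A1 A2 A3]] := IH w wb _ (n :: s).
  - apply: sub_countable cb; apply: subset_card_le => v vw.
    by apply: (wo_lt_le_trans wo) vw _; exact: wo_ltW.
  - by rewrite -cat_rcons.
  - by exists A; split=> // v vb fv; apply: A3; exact: wP.
have Es0 : E s := Es [::].
exists (\bigcup_n A n); split.
- move=> t [n _]; have [+ _ _] := AP n => /[apply]; rewrite /cone /=.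
  exact: suffix_trans (suffix_cons _ _).
- move=> B; rewrite nbhsE => -[V [oV Vs] VB].
  have [m mV] := oV _ Vs Es0.
  have [_ /(_ V) + _] := AP m; case.
    by apply: open_nbhs_nbhs; split=> //; exact: mV.
  by move=> t [At Vt]; exists t; split; [exists m | exact: VB].
have nstep t k n : suffix (k :: s) t -> suffix (n :: s) t -> k = n.
  move=> /suffixP[v ->] /suffixP[w] /(congr1 rev).
  rewrite !rev_cat !rev_cons !cat_rcons => /eqP.
  by rewrite eqseq_cat // eqxx => /andP[_ /eqP[]].
(* Terms equal to [s] push the question back to an earlier stage, hence the induction on the
   derivation. *)
move=> v vb H; move: H (erefl s) vb; move: {1 3}s => x.
elim=> {x v} [v x _ [n _ An]|v w u x vw uA IHu ux|v w x _ vw _ IHx] xs wb.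
- have [+ _ _] := AP n => /(_ _ An) /size_suffix.
  by rewrite -xs /= ltnn.
- have vb : lt v b by case: vw => vw _; exact: (wo_lt_le_trans wo) wb.
  rewrite -xs in ux.
  have [N _ /(_ N (leqnn N))[uN|[_ [k fk uN]]]] := cvg_children (f v) ux.
    by apply: (IHu N) => //; exact: wo_ltW.
  have [_ _ /(_ v vb fk)] := AP k; apply.
  (* Localising to the cone of [k :: s] leaves only the piece [A k] of the union. *)
  have /(seq_stage_local (@open_cone E (k :: s))) := uA N.
  rewrite uN => /(_ (suffix_refl _)).
  suff -> : \bigcup_n A n `&` cone (k :: s) = A k by [].
  apply/seteqP; split=> [t [[n _ An] kt]|t At].
    by have [/(_ _ An) nt _ _] := AP n; rewrite (nstep _ _ _ kt nt).
  by split; [exists k | have [/(_ _ At)] := AP k].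
- by apply: IHx => //; apply: (wo_trans wo) wb; exact: wo_ltW.
Qed.

End TreeOrder.

Lemma tree_order_omega1 (E : pred (seq nat)) s (a : wo_ordinal) :
  is_omega1 a -> (forall t, E (t ++ s)) ->
  has_sequential_order (tree_space E) a.
Proof.
move=> a1 Es; split=> [A|b bp bE].
  by apply: seq_stage_omega1 => //; exact: tree_sequential.
have [_ /(_ b bp) cb] := a1.
have [A [_ As /(_ b (wo_refl (@wo_leP a) b))]] := late_stage (@wo_leP a) cb Es.
by rewrite bE.
Qed.

(** * Levels of points, a topological invariant *)

(** Not a rank: a point may have several levels, or none. *)
Fixpoint limit_level (X : topologicalType) n : set X :=
  if n is m.+1 then [set x | seq_limits (@limit_level X m `\ x) x]
  else [set x | open [set x]].

Lemma limit_level_homeo (X Y : topologicalType) (f : X -> Y) (g : Y -> X) n x :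
  continuous f -> continuous g -> cancel f g -> cancel g f ->
  limit_level n x -> limit_level n (f x).
Proof.
move=> cf cg fK gK; elim: n x => [|n IH] x /=.
  have -> : [set f x] = g @^-1` [set x].
    by apply/seteqP; split=> y /=; [move=> -> | move=> <-].
  by move/continuousP: cg; apply.
move=> [u [uA ux]]; exists (f \o u); split=> [k|].
  have [un ne] := uA k; split; first exact: IH.
  by move=> /= /(can_inj fK).
exact: (cvg_comp _ _ ux (cf x)).
Qed.

Section TreeLevels.
Variable E : pred (seq nat).
Local Notation X := (tree_space E).

Lemma tree_limit_level0 s : @limit_level X 0 s <-> ~~ E s.
Proof. exact: tree_isolated. Qed.

(** With [s] itself removed, a sequence converging to [s] must run through children of arbitrarily
    large index. *)
Lemma tree_limit_levelS n s : @limit_level X n.+1 s <->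
  E s /\ forall m, exists2 k, m <= k & @limit_level X n (k :: s).
Proof.
split=> [[u [uA us]]|[Es ch]].
  have H m : E s /\ exists2 k, m <= k & @limit_level X n (k :: s).
    have [N _ /(_ N (leqnn N))[uN|[Es [k mk uN]]]] := cvg_children m us.
      by have [_ /(_ uN)] := uA N.
    by split=> //; exists k => //; rewrite -uN; case: (uA N).
  by split=> [|m]; [case: (H 0) | case: (H m)].
have /choice[f fP] m : exists k, m <= k /\ @limit_level X n (k :: s).
  by have [k] := ch m; exists k.
exists (fun m => f m :: s); split=> [m|].
  by split; [case: (fP m) | exact: cons_neq].
by apply: cvg_children_seq => // m; case: (fP m).
Qed.

(** Children of [s] satisfy the hypothesis with [h - 1], so the height is the only level; height [0]
    means isolated. *)
Lemma tree_limit_level_height s h n :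
  (forall t, E (t ++ s) = (size t < h)) -> @limit_level X n s <-> n = h.
Proof.
elim: n s h => [|n IH] s h Es; have E0 : E s = (0 < h) := Es [::].
  by rewrite tree_limit_level0 E0; case: h {Es E0}.
rewrite tree_limit_levelS E0; case: h Es {E0} => [|h] Es.
  by split=> // -[].
have Hk k : @limit_level X n (k :: s) <-> n = h.
  by apply: IH => t; rewrite -cat_rcons Es size_rcons.
split=> [[_ /(_ 0)[k _ /Hk ->]//]|[nh]].
by split=> // m; exists m => //; apply/Hk.
Qed.

(** A level would descend along children to an isolated extension of [s]. *)
Lemma tree_limit_level_full s n :
  (forall t, E (t ++ s)) -> ~ @limit_level X n s.
Proof.
elim: n s => [|n IH] s Es; first by move/tree_limit_level0; rewrite (Es [::]).
move=> /tree_limit_levelS[_ /(_ 0)[k _]]; apply: IH => t.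
by rewrite -cat_rcons.
Qed.

End TreeLevels.

(** * Coding sets of integers, and the family of spaces *)

(** Reversal reads a node from the root, which is isolated. Branch [0] is the full tree giving order
    omega_1; [[:: n.+1]] is the point p_n, with even children isolated and odd ones rooting trees of
    height [n.+1]. *)
Definition coded_tree (r : nat -> bool) : pred (seq nat) := fun s =>
  match rev s with
  | [::] => false
  | 0 :: _ => true
  | n.+1 :: t => r n && (if t is k :: t' then odd k && (size t' <= n) else true)
  end.

Lemma coded_tree_code (r : nat -> bool) n :
  r n <-> exists x : tree_space (coded_tree r),
    @limit_level (tree_space (coded_tree r)) 1 x /\
    @limit_level (tree_space (coded_tree r)) n.+2 x.
Proof.
have Eh k j t : r j -> coded_tree r (t ++ [:: k; j.+1]) =
    (size t < if odd k then j.+1 else 0).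
  move=> rj; rewrite /coded_tree rev_cat /= rj size_rev; by case: odd.
have lvl k j i : r j ->
    @limit_level (tree_space (coded_tree r)) i [:: k; j.+1] <->
    i = if odd k then j.+1 else 0.
  by move=> rj; apply: tree_limit_level_height => t; exact: Eh.
split=> [rn|[x [x1 xn]]].
  have En : coded_tree r [:: n.+1] by rewrite /coded_tree /= rn.
  (* The even children give level [1], the odd ones level [n.+2]. *)
  exists [:: n.+1]; rewrite !tree_limit_levelS; split; split=> // m.
    by exists m.*2; [rewrite -addnn leq_addr | apply/lvl; rewrite ?odd_double].
  exists m.*2.+1; first by rewrite -addnn leqW // leq_addr.
  by apply/lvl; rewrite //= odd_double.
(* The root and the branches outside [r] are isolated, and branch [0] has no levels. At [[:: j.+1]]
   with [r j] the levels force [n = j]; deeper nodes have a single level. *)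
move: x1 xn; rewrite -(revK x); case: (rev x) => [|j y] {x}.
  by rewrite tree_limit_levelS => -[].
rewrite rev_cons -cats1; case: j => [|j].
  move=> /tree_limit_level_full[t].
  by rewrite /coded_tree !rev_cat.
have [rj|nrj] := boolP (r j); last first.
  by rewrite tree_limit_levelS /coded_tree rev_cat /= (negbTE nrj) => -[].
case: y => [|k y].
  move=> _ /tree_limit_levelS[_ /(_ 0)[k _]].
  by move=> /(lvl _ _ _ rj); case: odd => // -[->].
rewrite rev_cons -cats1 -catA.
(* Truncated subtraction: nodes past the height of their tree get [0], being isolated. *)
set h := (if odd k then j.+1 else 0) - size y.
have lh i :
    @limit_level (tree_space (coded_tree r)) i (rev y ++ [:: k; j.+1]) <-> i = h.
  apply: tree_limit_level_height => t.
  by rewrite catA (Eh _ _ _ rj) size_cat size_rev addnC -ltn_subRL.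
by move=> /lh h1 /lh; rewrite -h1.
Qed.

Theorem corollary5p4 :
  exists (I : Type) (X : I -> topologicalType),
    [/\ ~ countable [set: I],
        forall i : I, [/\ analytic_space (X i), sequential_space (X i)
                        & has_sequential_order (X i) omega1]
      & forall i j : I, i <> j -> ~ homeomorphic (X i) (X j)].
Proof.
exists (nat -> bool), (fun r => tree_space (coded_tree r)); split.
- exact: uncountable_cantor.
- move=> r; split; [exact: tree_analytic | exact: tree_sequential |].
  apply: (@tree_order_omega1 _ [:: 0]); first exact: omega1P.
  by move=> t; rewrite /coded_tree rev_cat.
- move=> r r' rr' [f [g [cf cg fK gK]]]; apply: rr'; apply/funext => n.
  apply/idP/idP => /coded_tree_code[x [x1 xn]]; apply/coded_tree_code.
    by exists (f x); split; apply: limit_level_homeo cf cg fK gK _.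
  by exists (g x); split; apply: limit_level_homeo cg cf gK fK _.
Qed.
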